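(* For every multi-index $\mu$ one has $\nabla s_{\mu}=s_{\mu^*}$ as sequences in $\mathbb{C}^{\mathbb{N}}$.
   Context: $\mathbb{N}=\{0,1,2,\ldots\}$. A multi-index is a nonempty finite sequence $\mu=(\mu_1,\ldots,\mu_p)$ of positive integers; its weight is $|\mu|=\mu_1+\cdots+\mu_p$. For $m\ge 1$ let $\mathcal{S}_m$ be the bijection from multi-indices of weight $m$ to subsets of $\{1,\ldots,m-1\}$ given by $\mathcal{S}_m(\mu_1,\ldots,\mu_p)=\{\mu_1+\cdots+\mu_k : 1\le k<p\}$. For $\mu$ of weight $m$, $\mu^*$ is the multi-index of weight $m$ with $\mathcal{S}_m(\mu^* )=\{1,\ldots,m-1\}\setminus\mathcal{S}_m(\mu)$. For $a\in\mathbb{C}^{\mathbb{N}}$, $(\Delta a)(n)=a(n)-a(n+1)$ and $(\nabla a)(n)=(\Delta^n a)(0)$; equivalently $(\nabla a)(n)=\sum_{k=0}^n(-1)^k\binom{n}{k}a(k)$. For a multi-index $\mu=(\mu_1,\ldots,\mu_p)$ and $n\in\mathbb{N}$, $$s_{\mu}(n)=\sum_{0\le n_1\le\cdots\le n_p=n}\frac{1}{(n_1+1)^{\mu_1}\cdots(n_p+1)^{\mu_p}}.$$ *)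

(* Defs.v *)
From HB Require Import structures.
From mathcomp Require Import all_boot all_order all_algebra.
From mathcomp Require Import reals complex.
Set Implicit Arguments.
Unset Strict Implicit.
Unset Printing Implicit Defensive.
Import Order.TTheory GRing.Theory Num.Theory.

Definition is_multiindex (mu : seq nat) : bool :=
  (mu != [::]) && all (leq 1) mu.

Record multiindex := Multiindex {
  mi_seq :> seq nat;
  mi_seqP : is_multiindex mi_seq
}.

HB.instance Definition _ := [isSub for mi_seq].
HB.instance Definition _ := [Choice of multiindex by <:].

Definition weight (mu : multiindex) : nat := sumn mu.

(* Subsets of {1, ..., m-1} are represented as sets over 'I_m = {0, ..., m-1}
   that do not contain 0, i.e. as subsets of [positive_ord m]. *)
Definition positive_ord (m : nat) : {set 'I_m} := [set i : 'I_m | (0 < i)%N].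

Definition partial_sums (m : nat) (mu : multiindex) : {set 'I_m} :=
  [set i : 'I_m | has (fun k => sumn (take k mu) == i) (iota 1 (size mu).-1)].

Definition is_dual (mu nu : multiindex) : bool :=
  (weight nu == weight mu) &&
  (partial_sums (weight mu) nu ==
     positive_ord (weight mu) :\: partial_sums (weight mu) mu).

Lemma sumn_pairmap_sub a s : path leq a s ->
  (a + sumn (pairmap (fun x y => y - x) a s) = last a s)%N.
Proof.
elim: s a => [|b s IH] a /=; first by rewrite addn0.
by case/andP=> ab /IH <-; rewrite addnA subnKC.
Qed.

Lemma pairmap_sub_pos a s : path ltn a s ->
  all (leq 1) (pairmap (fun x y => y - x)%N a s).
Proof.
by elim: s a => //= b s IH a /andP[ab /IH ->]; rewrite subn_gt0 ab.
Qed.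

Lemma take_pairmap (T1 T2 : Type) (f : T1 -> T1 -> T2) k a s :
  take k (pairmap f a s) = pairmap f a (take k s).
Proof. by elim: s a k => [|b s IH] a [|k] //=; rewrite IH. Qed.

Lemma weight_gt0 (mu : multiindex) : (0 < weight mu)%N.
Proof.
by case: mu => [[|[|a] s]]; rewrite /is_multiindex /weight.
Qed.

Lemma partial_sums_surj m (A : {set 'I_m}) : (0 < m)%N -> A \subset positive_ord m ->
  exists nu : multiindex, (weight nu = m) /\ partial_sums m nu = A.
Proof.
move=> m0 /subsetP sA.
pose e := [seq x <- iota 1 m.-1 | [exists i in A, nat_of_ord i == x]].
have eP (i : 'I_m) : (nat_of_ord i \in e) = (i \in A).
  rewrite mem_filter mem_iota add1n prednK // ltn_ord andbT.
  apply/andP/idP => [[/existsP[j /andP[jA /eqP/ord_inj <-]] _] //|iA].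
  split; first by apply/existsP; exists i; rewrite iA eqxx.
  by have := sA i iA; rewrite inE.
have sm : path ltn 0 (rcons e m).
  rewrite rcons_path path_sortedE; last exact: ltn_trans.
  apply/andP; split.
    apply/andP; split.
      by apply/allP => x; rewrite mem_filter mem_iota => /andP[_ /andP[]].
    by rewrite sorted_filter ?iota_ltn_sorted //; exact: ltn_trans.
  have := mem_last 0 e; rewrite inE => /orP[/eqP ->//|].
  by rewrite mem_filter mem_iota add1n prednK // => /and3P[].
have sml : path leq 0 (rcons e m) by apply: sub_path sm => x y /ltnW.
pose s := pairmap (fun x y => y - x)%N 0 (rcons e m).
have sP : is_multiindex s.
  rewrite /is_multiindex pairmap_sub_pos // andbT -size_eq0 size_pairmap.
  by rewrite size_rcons.
exists (Multiindex sP); split.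
  by rewrite /weight /= -[LHS]add0n sumn_pairmap_sub // last_rcons.
have takeE k : (k <= size e)%N -> sumn (take k s) = last 0 (take k e).
  move=> ke; rewrite take_pairmap -[LHS]add0n sumn_pairmap_sub.
    by rewrite -cats1 takel_cat.
  by rewrite -(cat_take_drop k (rcons e m)) cat_path in sml; case/andP: sml.
have lastE k : (0 < k <= size e)%N -> last 0 (take k e) = nth 0 e k.-1.
  case: k => // k /andP[_ ke]; rewrite (take_nth 0) // last_rcons //.
apply/setP => i; rewrite inE /= size_pairmap size_rcons /=.
rewrite -eP.
apply/hasP/idP => [[k]|ie].
  rewrite mem_iota add1n ltnS => /andP[k0 ke] /eqP <-.
  by rewrite takeE // lastE ?k0 // mem_nth // prednK.
exists (index (nat_of_ord i) e).+1; first by rewrite mem_iota /= add1n !ltnS index_mem.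
by rewrite takeE ?index_mem // lastE /= ?index_mem // nth_index.
Qed.

Lemma sumn_take_ltn (mu : multiindex) k l : (k < l <= size mu)%N ->
  (sumn (take k mu) < sumn (take l mu))%N.
Proof.
case: mu => s /= /andP[_ /allP sP].
elim: l => // l IH /andP[]; rewrite ltnS => kl ls.
have step : (sumn (take l s) < sumn (take l.+1 s))%N.
  by rewrite (take_nth 0) // sumn_rcons -[X in (X < _)%N]addn0 ltn_add2l sP ?mem_nth.
move: kl; rewrite leq_eqVlt => /orP[/eqP -> //|kl].
by apply: ltn_trans step; apply: IH; rewrite kl ltnW.
Qed.

Lemma partial_sums_inj m (mu nu : multiindex) :
  weight mu = m -> weight nu = m -> partial_sums m mu = partial_sums m nu ->
  mu = nu.
Proof.
move=> wmu wnu eS.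
pose ps (s : multiindex) := [seq sumn (take k s) | k <- iota 1 (size s).-1].
have sz (s : multiindex) : (0 < size s)%N.
  by case: s => s /= /andP[]; rewrite -size_eq0 lt0n.
have srt (s : multiindex) : sorted ltn (ps s).
  apply: (homo_sorted_in (P := [in iota 1 (size s).-1]) (e := ltn)); last 2 first.
  - exact/allP.
  - exact: iota_ltn_sorted.
  move=> k l _ lI kl; have : l \in iota 1 (size s).-1 by exact: lI.
  rewrite mem_iota add1n prednK // => /andP[_ ls].
  by apply: sumn_take_ltn; apply/andP; split=> //; exact: ltnW.
have memps (s : multiindex) (ws : weight s = m) (x : nat) :
    reflect (exists2 i : 'I_m, i \in partial_sums m s & x = i :> nat) (x \in ps s).
  apply: (iffP mapP) => [[k kI ->]|[j]].
    have km : (sumn (take k s) < m)%N.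
      move: kI; rewrite mem_iota add1n prednK // => /andP[_ ks].
      have := @sumn_take_ltn s k (size s); rewrite ks leqnn take_size => /(_ isT).
      by rewrite -ws.
    by exists (Ordinal km) => //; rewrite inE; apply/hasP; exists k.
  by rewrite inE => /hasP[k kI /eqP <-] ->; exists k.
have eps : ps mu = ps nu.
  apply: (irr_sorted_eq ltn_trans ltnn) => // x.
  by apply/(memps mu wmu)/(memps nu wnu); rewrite eS.
have esz : size mu = size nu.
  have := congr1 size eps; rewrite !size_map !size_iota => e.
  by rewrite -(prednK (sz mu)) e prednK.
have etk k : (k <= size mu)%N -> sumn (take k mu) = sumn (take k nu).
  case: k => [|k]; first by rewrite !take0.
  rewrite leq_eqVlt => /orP[/eqP ke|ks].
    by rewrite ke {2}esz !take_size; exact: etrans wmu (esym wnu).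
  have := congr1 (fun s => nth 0 s k) eps.
  have k1 : (k < (size mu).-1)%N by rewrite -ltnS prednK.
  by rewrite !(nth_map 0) ?size_iota -?esz // !nth_iota -?esz // add1n.
apply: val_inj; apply: (@eq_from_nth _ 0) => //= k ks.
have := etk k.+1 ks.
rewrite !(take_nth 0) -?esz // !sumn_rcons etk ?(ltnW ks) //.
exact: addnI.
Qed.

Lemma dual_exists (mu : multiindex) : exists nu : multiindex, is_dual mu nu.
Proof.
have [||nu [wnu snu]] := @partial_sums_surj (weight mu)
  (positive_ord (weight mu) :\: partial_sums (weight mu) mu).
- exact: weight_gt0.
- exact: subsetDl.
by exists nu; rewrite /is_dual wnu snu !eqxx.
Qed.

Definition dual (mu : multiindex) : multiindex := xchoose (dual_exists mu).

Lemma dualP (mu nu : multiindex) : reflect (nu = dual mu) (is_dual mu nu).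
Proof.
have dP : is_dual mu (dual mu) := xchooseP (dual_exists mu).
apply: (iffP idP) => [/andP[/eqP wnu /eqP snu]|-> //].
case/andP: dP => /eqP wd /eqP sd.
by apply: (partial_sums_inj wnu wd); rewrite snu sd.
Qed.

Local Open Scope ring_scope.

Definition Delta (V : zmodType) (a : nat -> V) : nat -> V :=
  fun n => a n - a n.+1.

Definition nabla (V : zmodType) (a : nat -> V) : nat -> V :=
  fun n => iter n (@Delta V) a 0%N.

(* A tuple t : p.-tuple 'I_n.+1 lists (n_1, ..., n_p); the bound n_i <= n built
   into the type is implied by n_1 <= ... <= n_p = n. *)
Definition s_ (R : realType) (mu : multiindex) : nat -> R[i] := fun n =>
  \sum_(t : (size mu).-tuple 'I_n.+1 |
        sorted leq (map val t) && (last 0%N (map val t) == n))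
    \prod_(k < size mu) ((tnth t k).+1%:R ^+ nth 0%N mu k)^-1.

(* Main.v *)
Require Import Defs.
From mathcomp Require Import all_boot all_order all_algebra.
From mathcomp Require Import reals complex.
From mathcomp Require Import boolp ring zify.
Set Implicit Arguments.
Unset Strict Implicit.
Unset Printing Implicit Defensive.
Import GRing.Theory Num.Theory.

(** Let [D a n = a n / (n + 1)] and [E a n = (a 0 + ... + a n) / (n + 1)].
    Appending a part [c] to a multi-index turns [s] into [D^(c-1) (E s)], so
    [s_mu] is obtained from the unit impulse at [0] by a word in the letters [E]
    and [D] of length [|mu|], with [E] exactly at the positions [0] and
    [S(mu)].  Since [nabla \o D = E \o nabla] and [nabla] is an involution,
    [nabla] exchanges the two letters, which is the complementation of [S(mu)];
    the initial letter is restored because [nabla] sends the unit impulse to the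
    constant [1] and [D 1 = E impulse]. *)

Local Open Scope ring_scope.

Section Nabla.
Variable V : zmodType.
Implicit Types a : nat -> V.

Lemma iter_DeltaS n a k :
  iter n.+1 (@Delta V) a k = iter n (@Delta V) a k - iter n (@Delta V) a k.+1.
Proof. by []. Qed.

(** [nabla] transposes the table of iterated differences: [x - (x - y) = y] trades a step in order
    for a step in position. *)
Lemma iter_Delta_nabla a j k :
  iter j (@Delta V) (nabla a) k = iter k (@Delta V) a j.
Proof.
elim: j k => [//|j IH] k.
by rewrite iter_DeltaS !IH iter_DeltaS opprB addrC subrK.
Qed.

Lemma nablaK : involutive (@nabla V).
Proof. by move=> a; apply: funext => n; rewrite /nabla iter_Delta_nabla. Qed.

End Nabla.

Section DivisionAndMean.
Variable F : numFieldType.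
Implicit Types a : nat -> F.

Definition div_succ a : nat -> F := fun n => a n / n.+1%:R.

Definition cumul a : nat -> F := fun n => \sum_(k < n.+1) a k.

Definition mean a : nat -> F := div_succ (cumul a).

Definition impulse : nat -> F := fun n => (n == 0%N)%:R.

Definition letter a (b : bool) : nat -> F := if b then mean a else div_succ a.

(** Leibniz rule: the second differences of the factor [i + 1] vanish, so only two terms survive. At
    [n = 0] the truncated [n.-1] comes with coefficient [0]. *)
Lemma iter_Delta_mul_succ a n k :
  iter n (@Delta F) (fun i => i.+1%:R * a i) k =
  (k + n).+1%:R * iter n (@Delta F) a k - n%:R * iter n.-1 (@Delta F) a k.
Proof.
elim: n k => [|n IH] k; first by rewrite /= addn0 mul0r subr0.
rewrite iter_DeltaS !IH [n.+1.-1]/= iter_DeltaS.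
case: n {IH} => [|n] /=; first by rewrite !addn0 addn1 /Delta; ring.
rewrite /Delta !addnS !addSn -!natr1; ring.
Qed.

Lemma div_succK a n : n.+1%:R * div_succ a n = a n.
Proof. by rewrite /div_succ mulrCA divff ?mulr1 // pnatr_eq0. Qed.

Lemma nabla_div_succ a : nabla (div_succ a) = mean (nabla a).
Proof.
apply: funext => n; set b := div_succ a.
have -> : a = (fun i => i.+1%:R * b i) by apply: funext => i; rewrite div_succK.
(* By the Leibniz rule at [k = 0], the summand of index [i] is [(i + 1) * nabla b i - i * nabla b (i
   - 1)], so the sum telescopes. *)
suff sumE : cumul (nabla (fun i => i.+1%:R * b i)) n = n.+1%:R * nabla b n.
  by rewrite /mean /div_succ sumE mulrC mulKf // pnatr_eq0.
rewrite /cumul; elim: n => [|n IH]; first by rewrite big_ord1 /nabla /=.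
by rewrite big_ord_recr /= IH /nabla iter_Delta_mul_succ add0n addrC subrK.
Qed.

Lemma nabla_mean a : nabla (mean a) = div_succ (nabla a).
Proof. by rewrite -{1}[a]nablaK -nabla_div_succ nablaK. Qed.

Lemma nabla_letters a w :
  nabla (foldl letter a w) = foldl letter (nabla a) (map negb w).
Proof.
elim: w a => [//|b w IH] a /=; rewrite IH; congr foldl.
by case: b; rewrite /= ?nabla_mean ?nabla_div_succ.
Qed.

Lemma cumul_impulse : cumul impulse = fun=> 1.
Proof.
by apply: funext => n; rewrite /cumul big_ord_recl big1 ?addr0.
Qed.

Lemma nabla_cst1 : nabla (fun=> 1 : F) = impulse.
Proof.
have iter0 n : iter n (@Delta F) (fun=> 0) = fun=> 0.
  by elim: n => //= n ->; apply: funext => k; rewrite /Delta subr0.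
apply: funext => -[|n]; rewrite /nabla //= -iterS iterSr.
by rewrite [Delta _](_ : _ = fun=> 0) ?iter0 //; apply: funext => k; rewrite /Delta subrr.
Qed.

Lemma nabla_impulse : nabla impulse = fun=> 1.
Proof. by rewrite -nabla_cst1 nablaK. Qed.

Definition append_part a (c : nat) : nat -> F :=
  fun n => cumul a n / n.+1%:R ^+ c.

Definition part_word (c : nat) : seq bool := true :: nseq c.-1 false.

Definition word (mu : seq nat) : seq bool := flatten (map part_word mu).

Lemma append_part_word a c : (0 < c)%N ->
  append_part a c = foldl letter a (part_word c).
Proof.
case: c => // c _; rewrite /part_word /=.
have foldlE b : foldl letter b (nseq c false) = fun n => b n / n.+1%:R ^+ c.
  elim: c b => [|c IH] b; apply: funext => n /=; first by rewrite expr0 divr1.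
  by rewrite IH /div_succ exprS invfM mulrA.
by rewrite foldlE; apply: funext => n; rewrite /append_part exprS invfM mulrA.
Qed.

Lemma append_parts_word a mu : all (leq 1) mu ->
  foldl append_part a mu = foldl letter a (word mu).
Proof.
elim: mu a => [//|c mu IH] a /= /andP[c0 mu0].
by rewrite append_part_word // IH // foldl_cat.
Qed.

(* The bound [N] is independent of the last entry [n], and the first entry has a
   free lower bound [m], so that parts can be split off from the front. *)
Definition chain_sum (N : nat) (mu : seq nat) (m n : nat) : F :=
  \sum_(t : (size mu).-tuple 'I_N |
        path leq m (map val t) && (last m (map val t) == n))
    \prod_(k < size mu) ((tnth t k).+1%:R ^+ nth 0%N mu k)^-1.

Lemma chain_sum_nil N m n : chain_sum N [::] m n = (m == n)%:R.
Proof.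
rewrite /chain_sum big_mkcond (big_pred1 [tuple]) /= => [|t]; last first.
  by rewrite [t]tuple0; apply/esym/eqP.
by rewrite big_ord0; case: eqP.
Qed.

Lemma chain_sum_cons N c mu m n :
  chain_sum N (c :: mu) m n =
  \sum_(j < N | (m <= j)%N) (j.+1%:R ^+ c)^-1 * chain_sum N mu j n.
Proof.
rewrite /chain_sum; under [RHS]eq_bigr do rewrite mulr_sumr.
rewrite pair_big_dep /=.
rewrite (reindex (fun p : 'I_N * (size mu).-tuple 'I_N => [tuple of p.1 :: p.2])) /=.
  apply: eq_big => [[j t] /=|[j t] _ /=]; first by rewrite andbA.
  rewrite big_ord_recl tnth0; congr (_ * _).
  by apply: eq_bigr => i _; rewrite tnthS.
exists (fun t => (thead t, [tuple of behead t])) => [[j t] _|t _] /=.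
  by rewrite theadE; congr pair; apply: val_inj.
by rewrite -tuple_eta.
Qed.

(** The weight [a] on the lower bound makes the induction close: exchanging the sums over [m] and
    the first entry [j] turns it into [append_part a c]. *)
Lemma sum_chain_sum N mu a n : (n < N)%N ->
  \sum_(m < N) a m * chain_sum N mu m n = foldl append_part a mu n.
Proof.
move=> nN; elim: mu a => [|c mu IH] a /=.
  rewrite (bigD1 (Ordinal nN)) //= chain_sum_nil eqxx mulr1 big1 ?addr0 // => i.
  by rewrite -val_eqE /= chain_sum_nil => /negPf ->; rewrite mulr0.
rewrite -IH; under eq_bigr do rewrite chain_sum_cons mulr_sumr big_mkcond /=.
rewrite exchange_big; apply: eq_bigr => j _ /=.
rewrite -big_mkcond /append_part /cumul (big_ord_widen N a) //=.
rewrite !mulr_suml; apply: eq_big => [i|i _]; first by rewrite ltnS.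
by rewrite mulrA.
Qed.

End DivisionAndMean.

Lemma s_word (R : realType) (mu : multiindex) :
  s_ R mu = foldl (@letter _) (@impulse R[i]) (word mu).
Proof.
case: mu => mu /= muP; case/andP: (muP) => mu0 mu1.
apply: funext => n; rewrite -append_parts_word //.
(* The impulse keeps only the lower bound [m = 0], which is vacuous, so that [path] amounts to
   [sorted]. *)
rewrite -(@sum_chain_sum _ n.+1) // big_ord_recl big1 => [|i _]; last by rewrite /impulse /= mul0r.
rewrite /impulse eqxx mul1r addr0 /s_ /chain_sum /=.
by apply: eq_bigl => t; case: (map _ _) => [|x l] /=.
Qed.

Local Open Scope nat_scope.

Lemma size_word mu : all (leq 1) mu -> size (word mu) = sumn mu.
Proof.
elim: mu => //= c mu IH /andP[c0 /IH <-].
by rewrite /= size_cat size_nseq -addSn prednK.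
Qed.

(** The only [true] in the word of a part is its first letter, so the [true] letters sit where parts
    begin: at the sums of proper prefixes, the empty one included. *)
Lemma nth_word mu i : all (leq 1) mu -> i < sumn mu ->
  nth false (word mu) i = has (fun k => sumn (take k mu) == i) (iota 0 (size mu)).
Proof.
elim: mu i => //= c mu IH i /andP[c0 mu1] imu.
rewrite (iotaDl 1 0) has_map.
case: i imu => [//|i] imu /=.
rewrite nth_cat size_nseq nth_nseq; case: ltnP => ic.
  by apply/esym/hasPn => k _ /=; lia.
rewrite IH //; last by lia.
by apply: eq_has => k /=; rewrite add0n; apply/eqP/eqP; lia.
Qed.

(** Away from [0], letter [i] tests membership of [i] in [partial_sums], so complementing that set
    negates the letter; letter [0] is [true] in every word. *)
Lemma word_dual (mu : multiindex) :
  word (dual mu) = true :: map negb (behead (word mu)).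
Proof.
have /dualP/andP[/eqP wE /eqP sE] : dual mu = dual mu by [].
move: (dual mu) wE sE => nu wE sE.
have posP (la : multiindex) : all (leq 1) la by case: la => la /= /andP[].
have headP (la : multiindex) : word la = true :: behead (word la).
  by case: la => -[|c la].
have szE (la : multiindex) : size (word la) = weight la by exact: size_word.
have memP (la : multiindex) (i : 'I_(weight mu)) : weight la = weight mu -> 0 < i ->
    nth false (word la) i = (i \in partial_sums (weight mu) la).
  move=> wla i0; rewrite nth_word -/(weight la) ?wla // inE.
  case: {wla} la => -[|c la] //= _.
  (* [nth_word] also counts the empty prefix, of sum [0], which [0 < i] rules out. *)
  by rewrite eq_sym (gtn_eqF i0).
have szmu := weight_gt0 mu.
apply: (@eq_from_nth _ false) => [|i].
  by rewrite /= size_map size_behead !szE wE prednK.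
rewrite szE wE => im; case: i im => [|i] im; first by rewrite headP.
rewrite (memP _ (Ordinal im)) // sE in_setD [X in _ && X]inE /= -(memP _ (Ordinal im)) //=.
by rewrite (nth_map false) ?nth_behead ?andbT // size_behead szE; lia.
Qed.

Theorem corollary3p9 (R : realType) (mu : multiindex) :
  nabla (s_ R mu) = s_ R (dual mu).
Proof.
rewrite !s_word nabla_letters nabla_impulse word_dual.
by case: mu => -[|c mu] //= _; rewrite /mean cumul_impulse.
Qed.
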